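(* Let $I=[0,1]$, let $f:I\to\mathbb{R}$ be continuous, and let $\beta\in(1,2)$. Then there exists a sequence $(g_n)$ of fractal functions $g_n:I\to\mathbb{R}$ converging uniformly to $f$ on $I$ such that $\dim_H G_{g_n}=\beta$ for every $n$.
   Context: Fractal (interpolation) function: let $0=x_0<x_1<\dots<x_N=1$ with $N\ge 2$, and let $y_0,\dots,y_N\in\mathbb{R}$. Put $I=[0,1]$ and $I_i=[x_{i-1},x_i]$ for $i\in J=\{1,\dots,N\}$. Let $L_i:I\to I_i$ be the affine maps with $L_i(x_0)=x_{i-1}$ and $L_i(x_N)=x_i$, and let $F_i:I\times\mathbb{R}\to\mathbb{R}$ be functions that are continuous in the first variable and contractive in the second variable (Lipschitz constant $<1$), with $F_i(x_0,y_0)=y_{i-1}$ and $F_i(x_N,y_N)=y_i$. Set $w_i(x,y)=(L_i(x),F_i(x,y))$. The iterated function system $(I\times\mathbb{R},\{w_i\}_{i\in J})$ has a unique attractor, i.e. a unique nonempty compact set $G$ with $G=\bigcup_{i\in J}w_i(G)$, and $G$ is the graph of a continuous function $I\to\mathbb{R}$ taking the value $y_i$ at $x_i$ for $i=0,\dots,N$. A function arising in this way is called a fractal interpolation function, or fractal function. $G_g=\{(x,g(x)):x\in I\}\subset\mathbb{R}^2$ denotes the graph of $g$, and $\dim_H$ is the Hausdorff dimension with respect to the Euclidean metric. *)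

(* Defs.v *)
From mathcomp Require Import all_boot all_order all_algebra.
From mathcomp Require Import all_classical all_reals all_analysis.

Set Implicit Arguments.
Unset Strict Implicit.
Unset Printing Implicit Defensive.

Import Order.TTheory GRing.Theory Num.Theory.
Import numFieldNormedType.Exports.

Local Open Scope classical_set_scope.
Local Open Scope ring_scope.

(* The library norm on R * R is the sup norm, hence an explicit distance. *)
Definition euclidean_dist (R : realType) (p q : R * R) : R :=
  Num.sqrt ((p.1 - q.1) ^+ 2 + (p.2 - q.2) ^+ 2).

Section Hausdorff.
Context {R : realType} {T : Type} (dist : T -> T -> R).
Local Open Scope ereal_scope.

(* -oo on the empty set. *)
Definition diameter (U : set T) : \bar R :=
  ereal_sup [set (dist p q)%:E | p in U & q in U].

(* The case split only matters for s = 0: a nonempty set then has weight 1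
   (0 `^ 0 = 1), the empty set weight 0. *)
Definition hausdorff_weight (s : R) (U : set T) : \bar R :=
  if U == set0 then 0 else poweR (diameter U) s.

Definition hausdorff_premeasure (s delta : R) (A : set T) : \bar R :=
  ereal_inf [set \sum_(0 <= k <oo) hausdorff_weight s (U k) |
    U in [set U : nat -> set T |
      A `<=` \bigcup_k U k /\ forall k, diameter (U k) <= delta%:E]].

(* The premeasure is nonincreasing in delta, so that this supremum is its
   limit as delta tends to 0. *)
Definition hausdorff_measure (s : R) (A : set T) : \bar R :=
  ereal_sup [set hausdorff_premeasure s delta A |
    delta in [set delta : R | (0 < delta)%R]].

Definition hausdorff_dim (A : set T) : \bar R :=
  ereal_inf [set s%:E |
    s in [set s : R | (0 <= s)%R /\ hausdorff_measure s A = 0]].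

End Hausdorff.

Definition graph_on (R : realType) (A : set R) (g : R -> R) : set (R * R) :=
  [set (t, g t) | t in A].

Definition is_attractor (T : topologicalType) (X : set T) (N : nat)
    (w : nat -> T -> T) (G : set T) : Prop :=
  [/\ G `<=` X, G !=set0, compact G & G = \bigcup_(i in `I_N) (w i @` G)].

(* Nodes (x i, y i) are indexed by i <= N; the maps are indexed by i < N,
   the i-th one sending [0, 1] onto [x i, x i.+1]. Values of x, y, L, F at
   larger indices are irrelevant, and so are those of F i t for t outside
   [0, 1]. *)
Record interpolation_data (R : realType) (N : nat) (x y : nat -> R)
    (F : nat -> R -> R -> R) : Prop := InterpolationData {
  interp_size : (2 <= N)%N ;
  interp_first : x 0%N = 0 ;
  interp_last : x N = 1 ;
  interp_incr : forall i, (i < N)%N -> x i < x i.+1 ;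
  interp_cont : forall i, (i < N)%N -> forall v,
    {within `[0, 1], continuous (fun t => F i t v)} ;
  interp_contr : forall i, (i < N)%N -> exists2 c : R, 0 <= c < 1 &
    forall t : R, t \in `[0, 1] -> c.-lipschitz (F i t) ;
  interp_left : forall i, (i < N)%N -> F i (x 0%N) (y 0%N) = y i ;
  interp_right : forall i, (i < N)%N -> F i (x N) (y N) = y i.+1
}.

(* line_path a b is the affine map with 0 |-> a and 1 |-> b. *)
Definition interpolation_map (R : realType) (x : nat -> R)
    (F : nat -> R -> R -> R) (i : nat) (p : R * R) : R * R :=
  (line_path (x i) (x i.+1) p.1, F i p.1 p.2).

(* The attractor of such a system is unique, and a function whose graph is
   the attractor is continuous on [0, 1] and takes the value y i at x i, so
   none of this is required separately. *)
Definition fractal_function (R : realType) (g : R -> R) : Prop :=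
  exists (N : nat) (x y : nat -> R) (F : nat -> R -> R -> R),
    interpolation_data N x y F /\
    @is_attractor (R * R)%type (`[0, 1] `*` setT) N (interpolation_map x F)
      (graph_on `[0, 1] g).

(* Main.v *)
Require Import Defs.
From mathcomp Require Import all_boot all_order all_algebra.
From mathcomp Require Import all_classical all_reals all_analysis.
From mathcomp Require Import zify ring lra.

Import Order.TTheory GRing.Theory Num.Theory.
Import numFieldNormedType.Exports.

Local Open Scope classical_set_scope.
Local Open Scope ring_scope.

(** The contractions F_i are only required to be Lipschitz with some constant
    c < 1 in the second variable, and c = 0 qualifies. So every continuous g is
    a fractal function: cut [0, 1] at 1/2 and let F_i (t, v) = g (L_i t), which
    ignores v; the resulting maps send the graph of g onto its two halves
    ([continuous_fractal]). What has to be shown is therefore that the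
    continuous functions whose graph has Hausdorff dimension exactly beta are
    uniformly dense.

    Lipschitz functions are dense ([lipschitz_approximation], an infimal
    convolution), and for Lipschitz p and small c > 0 the graph of p + c z has
    the dimension of the graph of z. This reduces the problem to one continuous
    model function z of graph dimension beta = 2 - H, with 0 < H < 1.

    The model is a coordinate function of a generalised Peano curve in base 3.
    Fix a set a of digit positions. The expansion of z t consists of the digits
    of t at the positions in a, each replaced by its complement d |-> 2 - d when
    the digits of t skipped so far have an odd sum. These reflections make z
    continuous, exactly as in the case of Peano's curve, where a consists of
    every other position. Let A_M be the number of positions below M in a. Then
    z maps a triadic interval of length 3^-M into a triadic interval (a row) of
    length 3^-A_M, and inside a fixed interval of length 3^-m the subintervals of
    length 3^-M are shared equally among the rows ([peano_row_fiber]): the digits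
    of z t are, up to reflection, independent digits of t. Choosing a such that
    A_M is the integer part of H M gives 3^A_M the order of (3^M)^H for any real
    H ([exists_rate]).

    Upper bound: z oscillates by at most 2 * 3^-A_M over a length 3^-M, so
    about (3^M)^(2 - H) squares of side 3^-M cover the graph ([graph_dim_le]).

    Lower bound, by the mass distribution principle applied to the image of
    Lebesgue measure under t |-> (t, z t): if U has diameter d, the equal
    sharing shows that the t with (t, z t) in U have measure at most a constant
    times d^(2 - H) ([zigzag_section]), hence the weights of a cover of the
    graph are bounded below ([graph_dim_ge]). Adding a Lipschitz p to c z only
    changes the constants ([lipschitz_zigzag_dim]). *)

(** * Digits of a generalised Peano coordinate *)

(** The index i stands for the M base-3 digits of t, together with its integer
    part, which is copied; the most significant digit has position 0. The second
    component is the parity of the sum of the digits skipped so far: it decides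
    whether later copied digits are reflected. *)
Fixpoint peano_state (a : nat -> bool) (M i : nat) : nat * bool :=
  if M isn't M'.+1 then (i, false) else
  let (r, p) := peano_state a M' (i %/ 3) in
  let d := (i %% 3)%N in
  if a M' then ((3 * r + (if p then 2 - d else d))%N, p) else (r, p (+) odd d).

Definition peano_row (a : nat -> bool) (M i : nat) : nat :=
  (peano_state a M i).1.

Definition moves (a : nat -> bool) (M : nat) : nat := \sum_(j < M) a j.

Lemma movesS (a : nat -> bool) M : moves a M.+1 = (moves a M + a M)%N.
Proof. by rewrite /moves big_ord_recr. Qed.

(** Continuity of the coordinate, in discrete form: neighbouring intervals lie
    in the same row or in adjacent ones. The parities have to be part of the
    invariant, because a carry turns trailing digits 2 into 0: reflections on
    the two sides must agree when the row moves, and be opposite when it stays. *)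
Lemma peano_state_succ (a : nat -> bool) M i :
  let: (r, p) := peano_state a M i in let: (r', p') := peano_state a M i.+1 in
  if p == p' then (if p then r = r'.+1 else r' = r.+1) else r' = r.
Proof.
elim: M i => [|M IH] i //=.
have [d [j [dlt ->]]] : exists d j, (d < 3)%N /\ i = (3 * j + d)%N.
  by exists (i %% 3)%N, (i %/ 3)%N; split; lia.
have -> : ((3 * j + d) %/ 3 = j)%N by lia.
have -> : ((3 * j + d) %% 3 = d)%N by lia.
have [d2|d2] := eqVneq d 2%N.
  subst d.
  have -> : ((3 * j + 2).+1 %/ 3 = j.+1)%N by lia.
  have -> : ((3 * j + 2).+1 %% 3 = 0)%N by lia.
  have := IH j.
  case: (peano_state a M j) => r p; case: (peano_state a M j.+1) => r' p'.
  by case: (a M); case: p => /=; case: p' => //=; lia.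
have -> : ((3 * j + d).+1 %/ 3 = j)%N by lia.
have -> : ((3 * j + d).+1 %% 3 = d.+1)%N by lia.
case: (peano_state a M j) => r p.
have {dlt d2} : d = 0%N \/ d = 1%N by lia.
by case: (a M); case: p => /=; case=> -> /=; lia.
Qed.

Lemma peano_row_succ (a : nat -> bool) M i :
  (peano_row a M i <= (peano_row a M i.+1).+1)%N /\
  (peano_row a M i.+1 <= (peano_row a M i).+1)%N.
Proof.
have := peano_state_succ a M i; rewrite /peano_row.
case: (peano_state a M i) => r p; case: (peano_state a M i.+1) => r' p' /=.
by case: p; case: p' => /=; lia.
Qed.

(** A copied digit refines the row by a factor 3, a skipped one keeps it; in
    both cases the new row lies inside the old one. *)
Lemma peano_row_nested (a : nat -> bool) M i :
  (3 ^ a M * peano_row a M (i %/ 3) <= peano_row a M.+1 i)%N /\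
  ((peano_row a M.+1 i).+1 <= 3 ^ a M * (peano_row a M (i %/ 3)).+1)%N.
Proof.
rewrite /peano_row /=; case: (peano_state a M (i %/ 3)) => r p /=.
by case: (a M); case: p => /=; rewrite ?expn1 ?expn0; lia.
Qed.

(** Equidistribution: of the 3^k subintervals of a level-m interval u, at most
    3^(k - (A_(m+k) - A_m)) lie in a given row v, where A = moves a. Going one
    level down, a copied digit is determined by the last digit of v and the
    parity, whereas a skipped digit is free. Multiplying out avoids the truncated
    subtraction in the exponent. *)
Lemma peano_row_fiber (a : nat -> bool) m k u v : exists s : seq nat,
  (size s * 3 ^ moves a (m + k) <= 3 ^ (k + moves a m))%N /\
  forall i, (i %/ 3 ^ k = u)%N -> peano_row a (m + k) i = v -> i \in s.
Proof.
elim: k v => [|k IH] v.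
  exists [:: u]; split; first by rewrite addn0 mul1n.
  by move=> i; rewrite expn0 divn1 => -> _; rewrite mem_seq1.
rewrite addnS movesS /peano_row /=; case E : (a (m + k)%N).
  have [s [sz sP]] := IH (v %/ 3)%N.
  pose e := (v %% 3)%N.
  exists [seq (3 * j + (if (peano_state a (m + k) j).2 then 2 - e else e))%N | j <- s].
  rewrite size_map; split.
    by rewrite addn1 expnS mulnCA addSn expnS leq_mul2l.
  move=> i; rewrite expnS divnMA => iu iv.
  apply/mapP; exists (i %/ 3)%N.
    apply: sP => //; rewrite /peano_row; move: iv.
    case: (peano_state a (m + k) (i %/ 3)) => r p /=.
    by case: p; lia.
  move: iv; rewrite /e; case: (peano_state a (m + k) (i %/ 3)) => r p /=.
  by case: p; lia.
have [s [sz sP]] := IH v.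
exists [seq (3 * j + d)%N | j <- s, d <- [:: 0; 1; 2]%N].
split.
  by rewrite size_allpairs addn0 addSn expnS mulnAC [(_ * 3)%N]mulnC leq_mul2l.
move=> i; rewrite expnS divnMA => iu iv.
apply/allpairsPdep; exists (i %/ 3)%N, (i %% 3)%N; split.
- apply: sP => //; rewrite /peano_row; move: iv.
  by case: (peano_state a (m + k) (i %/ 3)).
- have : (i %% 3 < 3)%N by rewrite ltn_mod.
  by case: (i %% 3)%N => [|[|[|]]].
- lia.
Qed.

(** * The zigzag function *)

Section Zigzag.
Context {R : realType} (a : nat -> bool).
Implicit Types (t u : R) (M : nat).

Definition triadic M t : nat := Num.truncn (3 ^+ M * t).

Lemma triadicS M t : (triadic M.+1 t %/ 3)%N = triadic M t.
Proof.
rewrite /triadic exprS -mulrA; set x := 3 ^+ M * t.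
have [x0|x0] := ltP x 0.
  have tn (y : R) : y < 0 -> Num.truncn y = 0%N.
    by move=> y0; apply/eqP; rewrite -leqn0 truncn_le_nat (lt_trans y0).
  by rewrite !tn//; lra.
have := truncn_itv (_ : 0 <= 3 * x); rewrite mulr_ge0// => /(_ isT).
set n := Num.truncn (3 * x) => /andP[n1 n2].
apply/esym/truncn_def.
have e : n%:R = 3 * (n %/ 3)%N%:R + (n %% 3)%N%:R :> R.
  by rewrite -natrM -natrD; congr (_%:R); lia.
have d0 : 0 <= (n %% 3)%N%:R :> R by [].
have d2 : (n %% 3)%N%:R <= 2 :> R by rewrite (ler_nat R _ 2); lia.
move: n1 n2; rewrite -!natr1 e; lra.
Qed.

Lemma triadicD m k t : (triadic (m + k) t %/ 3 ^ k)%N = triadic m t.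
Proof.
elim: k => [|k IH]; first by rewrite addn0 expn0 divn1.
by rewrite addnS expnS divnMA triadicS IH.
Qed.

Lemma triadic_itv M t : 0 <= t ->
  (triadic M t)%:R <= 3 ^+ M * t < (triadic M t).+1%:R.
Proof. by move=> t0; apply: truncn_itv; rewrite mulr_ge0// exprn_ge0. Qed.

Lemma triadic_le q M t u : 3 ^+ M * (t - u) <= q%:R ->
  (triadic M t <= triadic M u + q)%N.
Proof.
move=> tu; rewrite truncn_le_nat.
have := truncnS_gt (3 ^+ M * u); rewrite -/(triadic M u).
rewrite -[(triadic M u).+1%:R]natr1 -[(_ + _).+1%:R]natr1 natrD.
by move: tu; rewrite mulrBr; lra.
Qed.

Definition zigzag_lo t M : R :=
  (peano_row a M (triadic M t))%:R / 3 ^+ moves a M.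

Definition zigzag_hi t M : R :=
  (peano_row a M (triadic M t)).+1%:R / 3 ^+ moves a M.

Definition zigzag t : R := sup (range (zigzag_lo t)).

Lemma zigzag_lo_le_hi t M : zigzag_lo t M <= zigzag_hi t M.
Proof. by rewrite ler_pM2r ?invr_gt0 ?exprn_gt0// ler_nat. Qed.

Lemma zigzag_nested t M :
  zigzag_lo t M <= zigzag_lo t M.+1 /\ zigzag_hi t M.+1 <= zigzag_hi t M.
Proof.
have [] := peano_row_nested a M (triadic M.+1 t); rewrite triadicS => lo hi.
rewrite /zigzag_lo /zigzag_hi movesS exprD.
have A0 : 0 < 3 ^+ moves a M :> R by rewrite exprn_gt0.
have a0 : 0 < 3 ^+ a M :> R by rewrite exprn_gt0.
split; rewrite invfM mulrA mulrAC ler_pM2r ?invr_gt0//.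
  by rewrite ler_pdivlMr// mulrC -natrX -natrM ler_nat.
by rewrite ler_pdivrMr// mulrC -natrX -natrM ler_nat.
Qed.

Lemma zigzag_lo_homo t : {homo zigzag_lo t : M K / (M <= K)%N >-> M <= K}.
Proof.
by apply: homo_leq => [//|x y z|M]; [exact: le_trans|case: (zigzag_nested t M)].
Qed.

Lemma zigzag_hi_homo t : {homo zigzag_hi t : M K / (M <= K)%N >-> K <= M}.
Proof.
apply: homo_leq => [//|x y z|M]; last by case: (zigzag_nested t M).
by move=> yx zy; exact: le_trans zy yx.
Qed.

Lemma zigzag_lo_le t M K : zigzag_lo t M <= zigzag_hi t K.
Proof.
apply: le_trans (zigzag_lo_homo _ _ _ (leq_maxl M K)) _.
by apply: le_trans (zigzag_lo_le_hi _ _) (zigzag_hi_homo _ _ _ (leq_maxr M K)).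
Qed.

Lemma zigzag_itv t M : zigzag_lo t M <= zigzag t <= zigzag_hi t M.
Proof.
apply/andP; split.
  apply: ub_le_sup; last by exists M.
  by exists (zigzag_hi t 0%N) => _ [K _ <-]; exact: zigzag_lo_le.
apply: ge_sup; first by exists (zigzag_lo t 0%N), 0%N.
by move=> _ [K _ <-]; exact: zigzag_lo_le.
Qed.

Lemma zigzag_row M t :
  (peano_row a M (triadic M t))%:R <= 3 ^+ moves a M * zigzag t
    <= (peano_row a M (triadic M t)).+1%:R.
Proof.
have A0 : 0 < 3 ^+ moves a M :> R by rewrite exprn_gt0.
by have := zigzag_itv t M; rewrite ler_pdivrMr// ler_pdivlMr// mulrC.
Qed.

(** A triadic Hoelder estimate: points at distance at most 3^-M are in equal or
    neighbouring intervals, hence in equal or neighbouring rows. *)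
Lemma zigzag_osc M t u : 3 ^+ M * `|t - u| <= 1 ->
  3 ^+ moves a M * `|zigzag t - zigzag u| <= 2.
Proof.
move=> tu; have A0 : 0 < 3 ^+ M :> R by rewrite exprn_gt0.
have B0 : 0 < 3 ^+ moves a M :> R by rewrite exprn_gt0.
have tu1 : (triadic M t <= triadic M u + 1)%N.
  by apply/triadic_le/(le_trans _ tu); rewrite ler_pM2l// ler_norm.
have ut1 : (triadic M u <= triadic M t + 1)%N.
  by apply/triadic_le/(le_trans _ tu); rewrite ler_pM2l// distrC ler_norm.
have [r1 r2] : (peano_row a M (triadic M t) <= (peano_row a M (triadic M u)).+1)%N /\
               (peano_row a M (triadic M u) <= (peano_row a M (triadic M t)).+1)%N.
  have [->|[->|->]] : triadic M t = triadic M u \/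
      triadic M t = (triadic M u).+1 \/ triadic M u = (triadic M t).+1 by lia.
  - by split; lia.
  - by have [] := peano_row_succ a M (triadic M u).
  - by have [] := peano_row_succ a M (triadic M t).
have /andP[] := zigzag_row M t; have /andP[] := zigzag_row M u.
rewrite -{1}(ler_nat R) in r1; rewrite -(ler_nat R) in r2.
move: r1 r2; rewrite -[(peano_row _ _ (triadic M t)).+1%:R]natr1.
rewrite -[(peano_row _ _ (triadic M u)).+1%:R]natr1.
have -> : 3 ^+ moves a M * `|zigzag t - zigzag u| =
    `|3 ^+ moves a M * zigzag t - 3 ^+ moves a M * zigzag u|.
  by rewrite -mulrBr normrM gtr0_norm.
rewrite ler_norml.
by move=> *; apply/andP; split; lra.
Qed.

End Zigzag.

(** The number of copied digits among the first M is H M up to a bounded error: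
    the vertical scale 3^-A_M is comparable to (3^-M)^H. *)
Definition has_rate {R : realType} (a : nat -> bool) (H : R) : Prop :=
  forall M, 3 ^+ moves a M <= (3 ^+ M) `^ H <= 3 * 3 ^+ moves a M.

(** Copy the digit at position M exactly when the integer part of H M grows from
    M to M + 1. *)
Lemma exists_rate {R : realType} (H : R) : 0 <= H <= 1 ->
  exists a : nat -> bool, has_rate a H.
Proof.
move=> /andP[H0 H1].
pose A M := Num.truncn (H * M%:R).
have Anneg M : 0 <= H * M%:R by rewrite mulr_ge0.
have Aitv M : (A M)%:R <= H * M%:R < (A M).+1%:R by apply: truncn_itv.
have AS M : (A M <= A M.+1 <= (A M).+1)%N.
  apply/andP; split; first by apply: le_truncn; rewrite ler_wpM2l// ler_nat.
  rewrite truncn_le_nat; have /andP[_] := Aitv M.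
  by rewrite -[M.+1%:R]natr1 -[(A M).+2%:R]natr1 mulrDr; lra.
pose a M := (A M < A M.+1)%N.
have movesE M : moves a M = A M.
  elim: M => [|M IH]; first by rewrite /moves big_ord0 /A mulr0 truncn0.
  by rewrite movesS IH /a; have := AS M; lia.
exists a => M; rewrite movesE.
have exp3 n : 3 ^+ n = 3 `^ n%:R :> R by rewrite powR_mulrn.
have /andP[A1 A2] := Aitv M.
rewrite -exprS !exp3 -powRrM mulrC !ler_powR ?ler1n//.
exact: ltW.
Qed.

Lemma size_flatten_map_le (T U : eqType) (F : T -> seq U) (s : seq T) b c :
  (forall x, size (F x) * c <= b)%N ->
  (size (flatten (map F s)) * c <= size s * b)%N.
Proof.
move=> Fb; elim: s => //= x s IH.
by rewrite size_cat mulnDl mulSn leq_add.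
Qed.

(** * Measure of the part of the zigzag in a small square *)

Section Zigzag_sections.
Context {R : realType} (a : nat -> bool).
Local Notation mu := (@lebesgue_measure R).

Lemma triadic_union_measure M (s : seq nat) : exists B : set R,
  [/\ measurable B, (mu B <= ((size s)%:R / 3 ^+ M)%:E)%E &
      forall t, 0 <= t -> triadic M t \in s -> B t].
Proof.
elim: s => [|i s [B [mB muB Bs]]].
  by exists set0; rewrite measure0 mul0r.
have M0 : 0 < 3 ^+ M :> R by rewrite exprn_gt0.
exists (`[i%:R / 3 ^+ M, i.+1%:R / 3 ^+ M[ `|` B); split.
- exact: measurableU.
- rewrite (le_trans (measureU2 _ _ _))//= -[(size s).+1%:R]nat1r mulrDl EFinD leeD//.
  rewrite lebesgue_measure_itv/= lte_fin ltr_pM2r ?invr_gt0// ltr_nat ltnSn.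
  by rewrite -EFinB lee_fin -mulrBl -[i.+1%:R]natr1 addrAC subrr add0r mul1r.
- move=> t t0; rewrite inE => /predU1P[ti|/(Bs _ t0)]; last by right.
  left; rewrite /= in_itv/= ler_pdivrMr// ltr_pdivlMr// mulrC -ti.
  exact: triadic_itv.
Qed.

(** With d of order 3^-m, the points t within d of t0 lie in at most 7 intervals
    of level m. At a level m + k so fine that rows are not longer than d, the
    constraint on zigzag a t leaves a number of rows of order 3^A_(m+k) d. By
    equidistribution each of the pairs accounts for few intervals. *)
Lemma zigzag_section_cover m k (t0 d : R) (q : nat) :
  1 <= 3 ^+ m * d <= 3 -> 1 <= 3 ^+ moves a (m + k) * d ->
  exists s : seq nat,
    (size s)%:R / 3 ^+ (m + k) <=
      7 * (2 * q%:R + 3) * (d * (3 ^+ moves a m / 3 ^+ m)) /\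
    forall t, `|t - t0| <= d -> `|zigzag a t - zigzag a t0| <= q%:R * d ->
      triadic (m + k) t \in s.
Proof.
move=> /andP[md1 md3] Ad1; pose M := (m + k)%N.
have d0 : 0 < d.
  by have := lt_le_trans ltr01 md1; rewrite pmulr_rgt0// exprn_gt0.
have A0 : 0 < 3 ^+ moves a M :> R by rewrite exprn_gt0.
pose w := (1 + Num.truncn (q%:R * (3 ^+ moves a M * d)))%N.
pose us := iota (triadic m t0 - 3) 7.
pose vs := iota (peano_row a M (triadic M t0) - w) (2 * w + 1).
(* Pairs of a level-m interval and a level-(m+k) row. *)
have /choice[F FP] (uv : nat * nat) := peano_row_fiber a m k uv.1 uv.2.
exists (flatten [seq F uv | uv <- [seq (u, v) | u <- us, v <- vs]]); split.
  have := size_flatten_map_le _ _ F [seq (u, v) | u <- us, v <- vs]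
    _ _ (fun uv => (FP uv).1).
  rewrite size_allpairs !size_iota.
  set n := size _; rewrite -(ler_nat R) !natrM natrD !natrX.
  set A := 3 ^+ moves a (m + k) => nle.
  have qAd0 : 0 <= q%:R * (A * d) by rewrite mulr_ge0// mulr_ge0 ?ltW.
  have wle : (2 * w)%:R + 1 <= (2 * q%:R + 3) * (A * d).
    have := truncn_itv qAd0; rewrite natrM natrD => /andP[+ _].
    by rewrite -/A in Ad1; lra.
  rewrite exprD ler_pdivrMr ?mulr_gt0 ?exprn_gt0//.
  rewrite -(ler_pM2r A0) (le_trans nle)// exprD.
  have -> : 7 * (2 * q%:R + 3) * (d * (3 ^+ moves a m / 3 ^+ m)) *
      (3 ^+ m * 3 ^+ k) * A =
      7 * ((2 * q%:R + 3) * (A * d)) * (3 ^+ k * 3 ^+ moves a m).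
    by field; rewrite lt0r_neq0// exprn_gt0.
  rewrite ler_pM2r ?mulr_gt0 ?exprn_gt0//.
  by rewrite ler_pM2l.
move=> t td zd; apply/flatten_mapP.
exists (triadic m t, peano_row a M (triadic M t)).
  apply/allpairsP; exists (triadic m t, peano_row a M (triadic M t)); split => //=.
    rewrite mem_iota.
    have : (triadic m t <= triadic m t0 + 3)%N.
      apply/triadic_le/(le_trans _ md3); rewrite ler_pM2l ?exprn_gt0//.
      exact: le_trans (ler_norm _) td.
    have : (triadic m t0 <= triadic m t + 3)%N.
      apply/triadic_le/(le_trans _ md3); rewrite ler_pM2l ?exprn_gt0//.
      by apply: le_trans (ler_norm _) _; rewrite distrC.
    lia.
  rewrite mem_iota.
  have /andP[r1 r2] := zigzag_row a M t; have /andP[r3 r4] := zigzag_row a M t0.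
  have : 3 ^+ moves a M * `|zigzag a t - zigzag a t0| <=
      q%:R * (3 ^+ moves a M * d) by rewrite mulrCA ler_pM2l.
  rewrite -{1}(gtr0_norm A0) -normrM mulrBr ler_norml => /andP[z1 z2].
  have := truncnS_gt (q%:R * (3 ^+ moves a M * d)).
  set T := Num.truncn _ => T1.
  have wE : w%:R = T.+1%:R :> R by [].
  have r5 : (peano_row a M (triadic M t) < (peano_row a M (triadic M t0) + w).+1)%N.
    rewrite -(ltr_nat R) -addSn natrD wE.
    by move: r1 r2 r3 r4 z1 z2 T1; lra.
  have r6 : (peano_row a M (triadic M t0) < (peano_row a M (triadic M t) + w).+1)%N.
    rewrite -(ltr_nat R) -addSn natrD wE.
    by move: r1 r2 r3 r4 z1 z2 T1; lra.
  by move: w r5 r6 {wE vs} => w; clear; lia.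
apply: (FP _).2 => //=; exact: triadicD.
Qed.

(** The scale of d: the least m with 3^-m <= d. *)
Lemma exists_triadic_scale (d : R) : 0 < d <= 1 ->
  exists m, 1 <= 3 ^+ m * d <= 3.
Proof.
move=> /andP[d0 d1].
have exm : exists m, 1 <= 3 ^+ m * d.
  exists (Num.truncn d^-1).+1; rewrite -ler_pdivrMr// mul1r.
  have /ltW/le_trans -> // := truncnS_gt d^-1.
  by rewrite -natrX ler_nat ltnW// ltn_expl.
case: (ex_minnP exm) => -[|m] md mmin; exists m.+1 || exists 0%N; rewrite md/=.
  by rewrite expr0 mul1r; lra.
rewrite exprS -mulrA ger_pMr// leNgt; apply/negP => /ltW/mmin.
by rewrite ltnn.
Qed.

Lemma moves_unbounded (H : R) : 0 < H ->
  has_rate a H ->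
  forall (K : R) m, exists k, K <= 3 ^+ moves a (m + k).
Proof.
move=> H0 aH K m; have [K0|K0] := lerP K 0.
  by exists 0%N; rewrite (le_trans K0)// exprn_ge0.
have K30 : 0 <= 3 * K by lra.
pose x := (3 * K) `^ H^-1.
exists (Num.truncn x).+1; set M := (_ + _)%N.
have xM : x <= 3 ^+ M.
  have /ltW/le_trans -> // := truncnS_gt x.
  rewrite -natrX ler_nat (leq_trans _ (ltnW (ltn_expl M _)))//.
  exact: leq_addl.
have : x `^ H <= (3 ^+ M) `^ H.
  by rewrite ge0_ler_powR ?nnegrE ?powR_ge0 ?exprn_ge0// ltW.
rewrite /x -powRrM mulVf ?gt_eqF// powRr1//.
by have /andP[_ /[swap] /le_trans/[apply]] := aH M; rewrite ler_pM2l.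
Qed.

(** The estimate behind the lower bound on the dimension: Lebesgue measure lifted
    to the graph gives a square of side d a mass of order d^(2 - H). The d^2
    comes from the area of the square; the factor d^-H is the vertical density
    3^A_m of the graph over an interval of length 3^-m comparable to d. *)
Lemma zigzag_section (H : R) (q : nat) : 0 < H <= 1 ->
  has_rate a H ->
  forall t0 d : R, 0 < d <= 1 -> exists B : set R,
  [/\ measurable B,
      (mu B <= (21 * (2 * q%:R + 3) * d `^ (2 - H))%:E)%E &
      forall t, 0 <= t -> `|t - t0| <= d ->
        `|zigzag a t - zigzag a t0| <= q%:R * d -> B t].
Proof.
move=> /andP[H0 H1] aH t0 d d01; have /andP[d0 d1] := d01.
have [m md] := exists_triadic_scale d d01.
have [k kd] := moves_unbounded H H0 aH d^-1 m.
rewrite -[d^-1]mul1r ler_pdivrMr// in kd.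
have [s [sz sP]] := zigzag_section_cover m k t0 d q md kd.
have [B [mB muB BP]] := triadic_union_measure (m + k) s.
exists B; split=> // [|t t00 td zd]; last by apply: BP => //; exact: sP.
rewrite (le_trans muB)// lee_fin (le_trans sz)//.
have -> : 21 * (2 * q%:R + 3) * d `^ (2 - H) =
    7 * (2 * q%:R + 3) * (3 * d `^ (2 - H)) by ring.
rewrite ler_pM2l; last by rewrite mulr_gt0// ltr_wpDl.
have /andP[md1 md3] := md; have /andP[Hm _] := aH m.
have M0 : 0 < 3 ^+ m :> R by rewrite exprn_gt0.
have Md : (3 ^+ m) `^ H <= 3 * d `^ (- H).
  rewrite powRN.
  have : (3 ^+ m * d) `^ H <= 3 `^ 1.
    apply: (@le_trans _ _ (3 `^ H)); last by rewrite ler_powR ?ler1n.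
    by rewrite ge0_ler_powR ?nnegrE ?(ltW H0)// mulr_ge0// ltW.
  by rewrite powRM ?(ltW M0) ?(ltW d0)// powRr1// -ler_pdivlMr ?powR_gt0.
have -> : d `^ (2 - H) = d * (d * d `^ (- H)).
  rewrite powRD; last by apply/implyP => _; rewrite gt_eqF.
  by rewrite powR_mulrn ?(ltW d0)// mulrA.
rewrite [leRHS]mulrCA ler_pM2l// ler_pdivrMr//.
rewrite (le_trans Hm)// (le_trans Md)//.
have := powR_gt0 (- H) d0; set e := d `^ _ => e0.
have -> : 3 * (d * e) * 3 ^+ m = (3 * e) * (3 ^+ m * d) by ring.
by rewrite ler_peMr// mulr_ge0// ltW.
Qed.

End Zigzag_sections.

(** * Continuity of the zigzag *)

Lemma continuous_dist {R : realType} (h : R -> R) :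
  (forall x e, 0 < e ->
     exists2 d, 0 < d & forall y, `|x - y| < d -> `|h x - h y| <= e) ->
  continuous h.
Proof.
move=> hd x; apply/cvgrPdist_le => e e0; have [d d0 xd] := hd x e e0.
by apply/nbhs_ballP; exists d => // y; exact: xd.
Qed.

Lemma lipschitz_continuous {R : realType} (p : R -> R) (L : R) : 0 <= L ->
  (forall t u, `|p t - p u| <= L * `|t - u|) -> continuous p.
Proof.
move=> L0 pL; apply: continuous_dist => x e e0.
have L1 : 0 < L + 1 by lra.
exists (e / (L + 1)) => [|y]; first by rewrite divr_gt0.
rewrite ltr_pdivlMr// mulrDr mulr1 mulrC => xy.
by apply: le_trans (pL _ _) _; have := normr_ge0 (x - y); lra.
Qed.

Lemma zigzag_le2 {R : realType} (a : nat -> bool) (t : R) : 0 <= t <= 1 ->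
  `|zigzag a t| <= 2.
Proof.
move=> /andP[t0 t1].
have := zigzag_row a 0%N t; rewrite /moves !big_ord0 expr0 mul1r.
have : (triadic 0 t <= 1)%N by rewrite truncn_le_nat expr0 mul1r; lra.
rewrite /peano_row/= -(ler_nat R) -[(triadic 0 t).+1%:R]natr1 => t01 /andP[z0 z1].
rewrite ger0_norm; last exact: (le_trans (ler0n _ _) z0).
by apply: le_trans z1 _; lra.
Qed.

Lemma zigzag_continuous {R : realType} (a : nat -> bool) (H : R) :
  0 < H -> has_rate a H -> continuous (zigzag a : R -> R).
Proof.
move=> H0 aH; apply: continuous_dist => t r r0.
have [M Mr] := moves_unbounded a H H0 aH (2 / r) 0%N; rewrite add0n in Mr.
have M0 : 0 < 3 ^+ M :> R by rewrite exprn_gt0.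
exists (3 ^+ M)^-1 => [|u]; first by rewrite invr_gt0.
rewrite -[ltRHS]mul1r ltr_pdivlMr// mulrC => /ltW tu.
have A0 : 0 < 3 ^+ moves a M :> R by rewrite exprn_gt0.
rewrite -(ler_pM2l A0) (le_trans (zigzag_osc a M t u tu))//.
by rewrite -ler_pdivrMr.
Qed.

(** * Hausdorff measure and dimension of graphs *)

Section Hausdorff_bounds.
Context {R : realType} {T : Type} (dist : T -> T -> R).
Implicit Types (A U : set T) (s d : R).

Lemma diameter_le U d : (forall p q, U p -> U q -> dist p q <= d) ->
  (diameter dist U <= d%:E)%E.
Proof.
by move=> Ud; apply: ge_ereal_sup => _ [p Up [q Uq <-]]; rewrite lee_fin Ud.
Qed.

Lemma le_diameter U p q : U p -> U q -> ((dist p q)%:E <= diameter dist U)%E.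
Proof. by move=> Up Uq; apply: ereal_sup_ubound; exists p => //; exists q. Qed.

Lemma hausdorff_weight_ge0 s U : (0 <= hausdorff_weight dist s U)%E.
Proof. by rewrite /hausdorff_weight; case: ifP => // _; exact: poweR_ge0. Qed.

Lemma hausdorff_weight0 s : hausdorff_weight dist s set0 = 0%E.
Proof. by rewrite /hausdorff_weight eqxx. Qed.

Lemma hausdorff_weight_le s U d : 0 <= s -> (forall p, dist p p = 0) ->
  (forall p q, U p -> U q -> dist p q <= d) ->
  (hausdorff_weight dist s U <= (d `^ s)%:E)%E.
Proof.
move=> s0 dist0 Ud; rewrite /hausdorff_weight; case: ifPn => [_|].
  by rewrite lee_fin powR_ge0.
move=> /set0P[p Up].
have := diameter_le _ _ Ud; have := le_diameter _ _ _ Up Up; rewrite dist0.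
case: (diameter dist U) => [r| |]; rewrite ?lee_fin// => r0 rd.
by apply: ge0_ler_powR => //; rewrite nnegrE // (le_trans r0).
Qed.

Lemma hausdorff_premeasure_ge0 s d A :
  (0 <= hausdorff_premeasure dist s d A)%E.
Proof.
apply: le_ereal_inf_tmp => _ [U _ <-].
by apply: nneseries_ge0 => *; exact: hausdorff_weight_ge0.
Qed.

Lemma hausdorff_premeasure_le s d A :
  (0 < d) -> (hausdorff_premeasure dist s d A <= hausdorff_measure dist s A)%E.
Proof. by move=> d0; apply: ereal_sup_ubound; exists d. Qed.

(** Finite covers by sets of equal size suffice for an upper bound; they are
    padded with empty sets, which have weight 0. *)
Lemma hausdorff_measure_eq0 s A : 0 <= s -> (forall p, dist p p = 0) ->
  (forall e, 0 < e -> exists (n : nat) (d : R) (U : nat -> set T),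
    [/\ d <= e, A `<=` \bigcup_(k in `I_n) U k,
        forall k p q, U k p -> U k q -> dist p q <= d & n%:R * d `^ s <= e]) ->
  hausdorff_measure dist s A = 0%E.
Proof.
move=> s0 dist0 cover; apply/eqP; rewrite eq_le; apply/andP; split; last first.
  exact: le_trans (hausdorff_premeasure_ge0 _ _ _)
    (hausdorff_premeasure_le _ _ _ ltr01).
apply: ge_ereal_sup => _ [delta /= delta0 <-].
apply/lee_addgt0Pr => e e0; rewrite add0e.
have [|n [d [U [de AU Ud nd]]]] := cover (Num.min e delta).
  by rewrite lt_min e0.
pose V k := if (k < n)%N then U k else set0.
apply: (@le_trans _ _ (\sum_(0 <= k <oo) hausdorff_weight dist s (V k))%E).
  apply: ereal_inf_lbound; exists V => //; split.
    by move=> p /AU[k /= kn Ukp]; exists k => //; rewrite /V kn.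
  move=> k; apply: (@le_trans _ _ d%:E).
    by apply: diameter_le => p q; rewrite /V; case: ifP => // _; exact: Ud.
  by rewrite lee_fin (le_trans de)// ge_min lexx orbT.
rewrite (nneseries_split 0 n); last by move=> *; exact: hausdorff_weight_ge0.
rewrite add0n eseries0 ?adde0; last first.
  by move=> k nk _; rewrite /V ltnNge nk/= hausdorff_weight0.
rewrite big_mkord; apply: (@le_trans _ _ (\sum_(k < n) (d `^ s)%:E)%E).
  apply: lee_sum => k _; rewrite /V ltn_ord; apply: hausdorff_weight_le => //.
  exact: Ud.
rewrite sumEFin lee_fin sumr_const card_ord -[leLHS]mulr_natl (le_trans nd)//.
by rewrite ge_min lexx.
Qed.

End Hausdorff_bounds.

Section Graph_dimension.
Context {R : realType}.
Local Notation mu := (@lebesgue_measure R).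
Local Notation dist := (@euclidean_dist R).

Lemma euclidean_dist_refl p : dist p p = 0.
Proof. by rewrite /euclidean_dist !subrr expr0n addr0 sqrtr0. Qed.

Lemma euclidean_dist_ge p q :
  `|p.1 - q.1| <= dist p q /\ `|p.2 - q.2| <= dist p q.
Proof.
by split; rewrite -sqrtr_sqr ler_wsqrtr// (lerDl, lerDr) sqr_ge0.
Qed.

Lemma euclidean_dist_le p q : dist p q <= `|p.1 - q.1| + `|p.2 - q.2|.
Proof.
rewrite /euclidean_dist; move: (p.1 - q.1) (p.2 - q.2) => x y.
have -> : `|x| + `|y| = Num.sqrt ((`|x| + `|y|) ^+ 2).
  by apply/esym; rewrite sqrtr_sqr; apply: ger0_norm; exact: addr_ge0.
rewrite ler_wsqrtr// sqrrD !real_normK ?num_real// addrAC lerDl.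
by rewrite mulrn_wge0// mulr_ge0.
Qed.

(** The mass distribution principle for Lebesgue measure lifted to the graph.
    Each set U k of a cover has a measurable shadow on [0, 1] of measure at most
    C times its weight, and the shadows cover [0, 1], so the weights add up to
    at least 1 / C. Allowing any measurable B above the shadow removes the
    question whether the shadow of an arbitrary set is measurable. *)
Lemma graph_dim_ge (g : R -> R) (beta C : R) : 0 < beta -> 0 < C ->
  (forall t0 d, 0 < d <= 1 -> exists B : set R,
    [/\ measurable B, (mu B <= (C * d `^ beta)%:E)%E &
        forall t, 0 <= t <= 1 -> `|t - t0| <= d -> `|g t - g t0| <= d -> B t]) ->
  (beta%:E <= hausdorff_dim dist (graph_on `[0%R, 1%R] g))%E.
Proof.
move=> beta0 C0 sec; apply: le_ereal_inf_tmp => _ [s [s0 Hs] <-].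
rewrite lee_fin leNgt; apply/negP => sbeta.
suff : (C^-1%:E <= hausdorff_premeasure dist s 1 (graph_on `[0%R, 1%R] g))%E.
  move=> /le_trans/(_ (hausdorff_premeasure_le _ _ _ _ ltr01)).
  by rewrite Hs lee_fin invr_le0 leNgt C0.
apply: le_ereal_inf_tmp => _ [U [gU diamU] <-].
have shadow k : exists B : set R, [/\ measurable B,
    (mu B <= C%:E * hausdorff_weight dist s (U k))%E &
    forall t, 0 <= t <= 1 -> U k (t, g t) -> B t].
  have [[t0 Ut0]|noU] := pselect (exists t0, U k (t0, g t0)); last first.
    exists set0; split=> [//||t _ Ut]; last by case: noU; exists t.
    by rewrite measure0 mule_ge0//; [rewrite lee_fin ltW|exact: hausdorff_weight_ge0].
  have := le_diameter dist _ _ _ Ut0 Ut0; rewrite euclidean_dist_refl.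
  rewrite /hausdorff_weight ifF; last by apply/negP => /eqP U0; rewrite U0 in Ut0.
  have near t : U k (t, g t) -> ((dist (t, g t) (t0, g t0))%:E <= diameter dist (U k))%E.
    by move=> Ut; exact: le_diameter.
  move: (diamU k) near; case: (diameter dist (U k)) => [d| |] //.
  rewrite !lee_fin poweR_EFin => d1 near.
  (* A set of diameter 0 meets the graph in one point. *)
  rewrite le_eqVlt => /predU1P[d0|d0].
    exists [set t0]; split; [exact: measurable_set1| |].
      rewrite lebesgue_measure_set1 -EFinM lee_fin.
      by apply: mulr_ge0; [exact: ltW|exact: powR_ge0].
    move=> t _ /near; rewrite lee_fin -d0 => dt.
    have [/le_trans/(_ dt) /=] := euclidean_dist_ge (t, g t) (t0, g t0).
    by rewrite normr_le0 subr_eq0 => /eqP.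
  have [|B [mB muB BP]] := sec t0 d; first by rewrite d0.
  exists B; split=> //.
    rewrite (le_trans muB)// -EFinM lee_fin ler_pM2l// ger_powR ?d0 ?(ltW sbeta)//.
  move=> t t01 /near; rewrite lee_fin => dt.
  have [/le_trans/(_ dt) /= ? /le_trans/(_ dt) /= ?] := euclidean_dist_ge (t, g t) (t0, g t0).
  exact: BP.
have [B BP] := choice shadow.
have : (mu `[0%R, 1%R] <= \sum_(0 <= k <oo) mu (B k))%E.
  apply: measure_sigma_subadditive => //.
  - by move=> k; have [] := BP k.
  - move=> t /= t01; have /gU[k _ Ut] : graph_on `[0, 1] g (t, g t) by exists t.
    by exists k => //; have [_ _] := BP k; apply; rewrite // in_itv/= in t01 *.
rewrite lebesgue_measure_itv/= lte_fin ltr01 oppr0 adde0 => mu1.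
rewrite -(@lee_pmul2l _ C%:E)// -EFinM mulfV ?gt_eqF//.
rewrite (le_trans mu1)// -nneseriesZl; last first.
  by move=> *; exact: hausdorff_weight_ge0.
by apply: lee_nneseries => k *; [exact: measure_ge0|have [] := BP k].
Qed.

End Graph_dimension.

Section Upper.
Context {R : realType}.
Local Notation dist := (@euclidean_dist R).

(** Over each interval of length 1/X the graph stays within a height 2 W / X, so
    2 W + 1 squares of side 1/X per interval suffice. *)
Lemma graph_box_cover (g : R -> R) (X W : R) :
  1 <= X -> 1 <= W ->
  (forall t u, X * `|t - u| <= 1 -> X * `|g t - g u| <= W) ->
  exists (n : nat) (U : nat -> set (R * R)),
  [/\ n%:R <= 6 * X * W,
      graph_on `[0, 1] g `<=` \bigcup_(k in `I_n) U k &
      forall k p q, U k p -> U k q -> dist p q <= 2 / X].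
Proof.
move=> X1 W1 osc; have X0 : 0 < X by lra.
have nX v : X * `|v| = `|X * v| by rewrite normrM gtr0_norm.
pose L := (Num.truncn (2 * W)).+1.
pose U k : set (R * R) := let i := (k %/ L)%N%:R in let j := (k %% L)%N%:R in
  [set p | (i <= X * p.1 <= i + 1) &&
           (j <= X * (p.2 - g (i / X)) + W <= j + 1)].
(* One more column than the integer part of X, for the endpoint t = 1. *)
exists ((Num.truncn X).+1 * L)%N, U; split.
- have := truncn_itv (_ : 0 <= X); rewrite ltW// => /(_ isT)/andP[x1 _].
  have := truncn_itv (_ : 0 <= 2 * W).
  rewrite mulr_ge0// ?(le_trans _ W1)// => /(_ isT)/andP[w1 _].
  rewrite natrM /L -[(Num.truncn X).+1%:R]natr1.
  rewrite -[(Num.truncn (2 * W)).+1%:R]natr1.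
  have -> : 6 * X * W = (2 * X) * (3 * W) by ring.
  by apply: ler_pM => //; lra.
- move=> _ [t /= + <-]; rewrite in_itv/= => /andP[t0 t1].
  have := truncn_itv (_ : 0 <= X * t); rewrite mulr_ge0// ?(ltW X0)// => /(_ isT).
  set i := Num.truncn _ => /andP[it ti].
  have := osc t (i%:R / X).
  have iX : X * (t - i%:R / X) = X * t - i%:R by field; rewrite gt_eqF.
  have -> : X * `|t - i%:R / X| = `|X * t - i%:R|.
    by rewrite nX iX.
  rewrite ger0_norm ?subr_ge0// lerBlDr.
  rewrite (le_trans (ltW ti)) ?nat1r// => /(_ isT).
  rewrite nX ler_norml => /andP[j0 j1].
  set y := X * (g t - g (i%:R / X)) in j0 j1.
  have := truncn_itv (_ : 0 <= y + W); rewrite -lerBlDr sub0r => /(_ j0).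
  set j := Num.truncn _ => /andP[jy yj].
  have jL : (j < L)%N.
    by rewrite ltnS /j; apply: le_truncn; lra.
  have iX1 : (i < (Num.truncn X).+1)%N.
    by rewrite ltnS /i; apply: le_truncn; rewrite ler_piMr// ltW.
  exists (i * L + j)%N => /=.
    by rewrite /= (leq_trans (_ : _ < i.+1 * L)%N) ?leq_mul2r ?iX1 ?orbT// mulSn addnC ltn_add2r.
  rewrite /U /= divnMDl// divn_small// addn0 modnMDl modn_small//.
  by rewrite it natr1 (ltW ti) jy natr1 ltW.
- move=> k p q /andP[/andP[p1 p2] /andP[p3 p4]] /andP[/andP[q1 q2] /andP[q3 q4]].
  apply: le_trans (euclidean_dist_le _ _) _.
  rewrite -(ler_pM2l X0) mulrDr !nX !mulrBr.
  have -> : X * (2 / X) = 1 + 1 by field; rewrite gt_eqF.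
  by apply: lerD; rewrite ler_norml; apply/andP; move: p3 p4 q3 q4; rewrite !mulrBr; split; lra.
Qed.

(** Hoelder continuity of exponent H, required only at the scales 3^-M, bounds
    the dimension of the graph by 2 - H: a cover by squares of side 1/X has
    about X^(2 - H) members. *)
Lemma graph_dim_le (g : R -> R) (H C : R) : 0 <= H <= 1 -> 1 <= C ->
  (forall M t u, 3 ^+ M * `|t - u| <= 1 ->
     (3 ^+ M) `^ H * `|g t - g u| <= C) ->
  (hausdorff_dim dist (graph_on `[0%R, 1%R] g) <= (2 - H)%:E)%E.
Proof.
move=> /andP[H0 H1] C1 osc; apply/lee_addgt0Pr => r r0.
rewrite -EFinD; set s := 2 - H + r.
have s0 : 0 <= s by rewrite /s; lra.
apply: ereal_inf_lbound; exists s => //; split=> //.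
apply: hausdorff_measure_eq0 => [//||e e0]; first exact: euclidean_dist_refl.
(* The total weight is at most K * e * X^-r, and X = 3 ^+ M is taken so large
   that X^r >= K. *)
pose K := 6 * C * 2 `^ s / e.
pose x := 2 / e + K `^ r^-1.
have C0 : 0 < C by lra.
have K0 : 0 < K by rewrite divr_gt0// mulr_gt0 ?powR_gt0// mulr_gt0.
have [M Mx] : exists M, x <= 3 ^+ M.
  exists (Num.truncn x).+1; have /ltW/le_trans -> // := truncnS_gt x.
  by rewrite -natrX ler_nat ltnW// ltn_expl.
have X1 : 1 <= 3 ^+ M :> R by rewrite exprn_ege1// ler1n.
move: (osc M) Mx X1; set X := 3 ^+ M => oscM Mx X1.
have X0 : 0 < X by lra.
have XH : 0 < X `^ H by rewrite powR_gt0.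
have XHX : X `^ H <= X by rewrite -[leRHS]powRr1 ?(ltW X0)// ler_powR.
have W1 : 1 <= C * (X / X `^ H).
  by rewrite -[leLHS]mulr1 ler_pM// ler_pdivlMr// mul1r.
have [t u tu|n [U [nle gU Ud]]] := graph_box_cover g X _ X1 W1.
  have := oscM _ _ tu; rewrite -(ler_pM2l X0) => /le_trans.
  move=> oscX; rewrite mulrA ler_pdivlMr// mulrC mulrCA [C * X]mulrC.
  exact: oscX.
exists n, (2 / X), U; split=> //.
  rewrite ler_pdivrMr// mulrC -ler_pdivrMr// (le_trans _ Mx)// lerDl.
  exact: powR_ge0.
have Kx : K <= X `^ r.
  have : (K `^ r^-1) `^ r <= X `^ r.
    apply: ge0_ler_powR; rewrite ?nnegrE ?powR_ge0 ?(ltW X0) ?(ltW r0)//.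
    by rewrite (le_trans _ Mx)// lerDr divr_ge0// ltW.
  by rewrite -powRrM mulVf ?gt_eqF// powRr1// ltW.
apply: (@le_trans _ _ (6 * X * (C * (X / X `^ H)) * (2 / X) `^ s)).
  by rewrite ler_wpM2r// powR_ge0.
have XV : (2 / X) `^ s = 2 `^ s / X `^ s.
  rewrite powRM ?invr_ge0 ?(ltW X0)//; congr (_ * _).
  by rewrite -powRN -mulN1r powRrM powR_inv1 ?(ltW X0).
have Xs : X `^ s = X * X / X `^ H * X `^ r.
  rewrite /s powRD ?(gt_eqF X0) ?implybT//; congr (_ * _).
  rewrite powRD ?(gt_eqF X0) ?implybT// powRN; congr (_ / _).
  by rewrite powR_mulrn ?(ltW X0)// expr2.
have Xr : 0 < X `^ r by rewrite powR_gt0.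
have -> : 6 * X * (C * (X / X `^ H)) * (2 / X) `^ s = K * e / X `^ r.
  rewrite XV Xs /K; field.
  by rewrite !gt_eqF.
by rewrite ler_pdivrMr// mulrC ler_pM2l.
Qed.

End Upper.

(** * Approximation by Lipschitz functions, and fractal functions *)

Section Approximation.
Context {R : realType}.

Lemma continuous_itv_unif (f : R -> R) (e : R) :
  {within `[0, 1], continuous f} -> 0 < e ->
  exists2 d, 0 < d & forall t u, 0 <= t <= 1 -> 0 <= u <= 1 ->
    `|t - u| < d -> `|f t - f u| <= e.
Proof.
move=> /subspace_continuousP fc e0.
pose P (d x : R) := 0 <= x <= 1 -> forall y, 0 <= y <= 1 ->
  `|y - x| < d -> `|f y - f x| <= e.
have e20 : 0 < e / 2 by rewrite divr_gt0.
have /compact_near_coveringP/(_ _ (0^'+ : set_system R) P _) cover :=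
  @segment_compact R 0 1.
have local (x : R) : `[0, 1]%classic x ->
    \forall x' \near x & d \near 0^'+, P d x'.
  move=> x01; have := fc x x01 => /cvgr_dist_le/(_ _ e20).
  rewrite near_withinE => /nbhs_ballP[r /= r0 fr].
  have r20 : 0 < r / 2 by rewrite divr_gt0.
  exists (ball x (r / 2), [set d | d < r / 2]); first split => /=.
  - exact: nbhsx_ballx.
  - exact: nbhs_right_lt.
  move=> [x' d] /= [xx' dr] x'01 y y01 yx'.
  have fx' : `|f x - f x'| <= e / 2.
    by apply: fr => //; apply: le_ball xx'; lra.
  have fy : `|f x - f y| <= e / 2.
    apply: fr => //; rewrite [r]splitr; apply: ball_triangle xx' _.
    by rewrite /ball/= distrC (lt_trans yx').
  have -> : f y - f x' = (f x - f x') - (f x - f y) by ring.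
  by rewrite (le_trans (ler_normB _ _))// [e]splitr lerD.
have pos : \forall d \near 0^'+, 0 < d :> R by exact: nbhs_right_gt.
have [d [dP d0]] := @filter_ex _ _ (at_right_proper_filter 0) _
  (filterI (cover local) pos).
exists d => // t u t01 u01 tu.
by apply: dP => //=; rewrite in_itv.
Qed.

(** The infimal convolution t |-> inf_s (f s + L |t - s|). It is below f; the s
    near t give values close to f t by uniform continuity, and for the others
    the penalty L |t - s| exceeds the oscillation of f once L is large. *)
Lemma lipschitz_approximation (f : R -> R) (e : R) :
  {within `[0, 1], continuous f} -> 0 < e ->
  exists (p : R -> R) (L : R),
  [/\ 0 <= L, forall t u, `|p t - p u| <= L * `|t - u| &
      forall t, 0 <= t <= 1 -> `|p t - f t| <= e].
Proof.
move=> fc e0; have [d d0 fd] := continuous_itv_unif f e fc e0.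
have [B B0 fB] : exists2 B, 0 <= B & forall t, 0 <= t <= 1 -> `|f t| <= B.
  have nfc : {within `[0, 1], continuous (fun t => `|f t|)}.
    by move=> x; apply: cvg_norm; exact: fc.
  have [c c01 cmax] := EVT_max ler01 nfc.
  by exists `|f c| => // t t01; apply: cmax; rewrite in_itv.
pose L := 2 * B / d.
have L0 : 0 <= L by rewrite divr_ge0 ?mulr_ge0// ltW.
pose E t := [set f s + L * `|t - s| | s in `[0, 1]].
have E0 t : E t !=set0 by exists (f 0 + L * `|t - 0|), 0 => //=; rewrite in_itv/= lexx ler01.
have Elb t : has_lbound (E t).
  exists (- B) => _ [s /= s01 <-].
  have := fB s; rewrite in_itv/= in s01; move=> /(_ s01); rewrite ler_norml => /andP[fs _].
  by rewrite (le_trans fs)// lerDl mulr_ge0.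
pose p t := inf (E t).
have plip t u : p t <= p u + L * `|t - u|.
  rewrite -lerBlDr; apply: lb_le_inf => // _ [s s01 <-].
  rewrite lerBlDr; apply: (@le_trans _ _ (f s + L * `|t - s|)).
    by apply: ge_inf => //; exists s.
  rewrite -addrA lerD2l -mulrDr ler_wpM2l//.
  have -> : t - s = (u - s) + (t - u) by ring.
  exact: ler_normD.
exists p, L; split=> //.
  move=> t u; rewrite ler_norml; apply/andP; split.
    by have := plip u t; rewrite distrC; lra.
  by have := plip t u; lra.
move=> t t01; rewrite distrC ler_norml; apply/andP; split.
  rewrite lerNl opprB lerBlDr; apply: (@le_trans _ _ (f t)); last by lra.
  apply: ge_inf => //; exists t; first by rewrite /= in_itv.
  by rewrite subrr normr0 mulr0 addr0.
rewrite lerBlDr addrC -lerBlDr; apply: lb_le_inf => // _ [s /= s01 <-].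
rewrite in_itv/= in s01; have [ts|ts] := ltP `|t - s| d.
  have := fd _ _ t01 s01 ts; rewrite ler_norml => /andP[_].
  have : 0 <= L * `|t - s| by rewrite mulr_ge0.
  lra.
have : 2 * B <= L * `|t - s|.
  by rewrite /L mulrAC -mulrA ler_peMr ?mulr_ge0// ler_pdivlMr// mul1r.
have := fB _ t01; have := fB _ s01; rewrite !ler_norml => /andP[s1 _] /andP[_ t1].
lra.
Qed.

(** The two maps copy the graph of g onto its left and right halves, regardless
    of the second coordinate, so they have contraction constant 0 in it. *)
Lemma continuous_fractal (g : R -> R) : continuous g -> fractal_function g.
Proof.
move=> gc; pose x i : R := i%:R / 2.
pose L i := line_path (x i) (x i.+1).
have LE i s : L i s = (s + i%:R) / 2.
  by rewrite /L line_pathEl /x -[i.+1%:R]natr1; field.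
have x0 : x 0%N = 0 by rewrite /x mul0r.
have x2 : x 2%N = 1 by rewrite /x divff.
exists 2%N, x, (g \o x), (fun i t v => g (L i t)); split.
  split => //.
  - by move=> i _; rewrite /x ltr_pM2r// ltr_nat.
  - move=> i _ v; apply: continuous_subspaceT => t.
    apply: continuous_comp; last exact: gc.
    have -> : L i = fun s => (s + i%:R) / 2 by apply/funext => s; exact: LE.
    apply: cvgMl; apply: cvgD; [exact: cvg_id|exact: cvg_cst].
  - move=> i _; exists 0; first by rewrite lexx ltr01.
    by move=> t _ [u v] _ /=; rewrite subrr normr0 mul0r.
  - by move=> i _; rewrite x0 /L line_path0.
  - by move=> i _; rewrite x2 /L line_path1.
split.
- by move=> _ [t t01 <-].
- by exists (0, g 0), 0 => //=; rewrite in_itv/= lexx ler01.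
- apply: (@continuous_compact _ _ (fun t => (t, g t))); last exact: segment_compact.
  apply: continuous_subspaceT => t.
  exact: (cvg_pair (F := nbhs t) (G := nbhs t) (H := nbhs (g t)) cvg_id (gc t)).
- apply/seteqP; split=> [_ [t /= + <-]|_ [i /= i2 [_ [t /= t01 <-] <-]]].
    rewrite in_itv/= => /andP[t0 t1].
    have [th|th] := leP t (1 / 2).
      exists 0%N => //; exists (2 * t, g (2 * t)).
        by exists (2 * t) => //=; rewrite in_itv/=; apply/andP; split; lra.
      rewrite /interpolation_map /= -/(L 0%N) LE.
      have -> : (2 * t + 0%:R) / 2 = t by field.
      by [].
    exists 1%N => //; exists (2 * t - 1, g (2 * t - 1)).
      by exists (2 * t - 1) => //=; rewrite in_itv/=; apply/andP; split; lra.
    rewrite /interpolation_map /= -/(L 1%N) LE.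
    have -> : (2 * t - 1 + 1%:R) / 2 = t by field.
    by [].
  exists (L i t) => //=.
  rewrite !in_itv/= LE in t01 *; move: t01 => /andP[t0 t1].
  have i0 : 0 <= i%:R :> R by [].
  have i1 : i%:R <= 1 :> R by rewrite (ler_nat R _ 1).
  by apply/andP; split; lra.
Qed.

End Approximation.


Lemma cvg_uniform_le {R : realType} (f : R -> R) (g : nat -> R -> R) (A : set R) :
  (forall n t, A t -> `|g n t - f t| <= n.+1%:R^-1) ->
  {uniform A, g @ \oo --> f}.
Proof.
move=> gf; move=> P /uniform_nbhs[E [entE EP]].
move: entE; rewrite -entourage_from_ballE => -[e /= e0 eE].
have [N _ Ne] := near_infty_natSinv_lt (PosNum e0).
exists N => // n /Ne ne; apply: EP => t At; apply: eE => /=.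
by rewrite /ball/= distrC (le_lt_trans (gf _ _ At)).
Qed.

(** * Density of continuous functions with prescribed graph dimension *)

Section Density.
Context {R : realType}.

(** Over a length d a Lipschitz p varies by at most L d, so it neither spoils
    the oscillation bound for c z nor lets z vary by more than a multiple of d
    when p + c z varies by at most d. *)
Lemma lipschitz_zigzag_dim (a : nat -> bool) (p : R -> R) (H L c : R) :
  0 < H <= 1 -> has_rate a H -> 0 <= L ->
  (forall t u, `|p t - p u| <= L * `|t - u|) -> 0 < c ->
  hausdorff_dim (@euclidean_dist R)
    (graph_on `[0, 1] (fun t => p t + c * zigzag a t)) = (2 - H)%:E.
Proof.
move=> H01 aH L0 pL c0; have /andP[H0 H1] := H01.
pose z : R -> R := zigzag a.
pose g t := p t + c * z t.
have gB t u : g t - g u = (p t - p u) + c * (z t - z u) by rewrite /g; ring.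
have osc M t u : 3 ^+ M * `|t - u| <= 1 ->
    (3 ^+ M) `^ H * `|g t - g u| <= L + 6 * c + 1.
  move=> tu.
  have X1 : 1 <= 3 ^+ M :> R by rewrite exprn_ege1// ler1n.
  have XH : (3 ^+ M) `^ H <= 3 ^+ M.
    by rewrite -[leRHS]powRr1 ?(le_trans _ X1)// ler_powR.
  have XH0 : 0 <= (3 ^+ M) `^ H by rewrite powR_ge0.
  rewrite gB (@le_trans _ _ ((3 ^+ M) `^ H * (L * `|t - u| + c * `|z t - z u|)))//.
    rewrite ler_wpM2l// (le_trans (ler_normD _ _))// lerD//.
    by rewrite normrM gtr0_norm.
  rewrite mulrDr.
  have : (3 ^+ M) `^ H * (L * `|t - u|) <= L.
    by rewrite mulrCA ler_piMr// (le_trans _ tu)// ler_wpM2r.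
  have : (3 ^+ M) `^ H * (c * `|z t - z u|) <= 6 * c.
    have /andP[_ aM] := aH M; have zM := zigzag_osc a M t u tu.
    rewrite mulrCA mulrC ler_pM2r//.
    rewrite (le_trans (ler_wpM2r _ aM))// -mulrA.
    by rewrite -/(z t) -/(z u) in zM *; lra.
  lra.
apply/eqP; rewrite eq_le; apply/andP; split.
  by apply: (graph_dim_le g H (L + 6 * c + 1)) => //; lra.
(* This q bounds the variation of the zigzag by q times that of g and t. *)
pose q := (Num.truncn ((1 + L) / c)).+1.
apply: (graph_dim_ge g (2 - H) (21 * (2 * q%:R + 3))).
- by lra.
- by rewrite mulr_gt0// ltr_wpDl.
- move=> t0 d d01.
  have [B [mB muB BP]] := zigzag_section a H q H01 aH t0 d d01.
  exists B; split=> // t /andP[t00 _] td gd; apply: BP => //.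
  have qc : (1 + L) / c <= q%:R by rewrite ltW// truncnS_gt.
  have d0 : 0 < d by case/andP: d01.
  rewrite (@le_trans _ _ ((1 + L) / c * d))//; last by rewrite ler_pM2r.
  rewrite mulrAC ler_pdivlMr// mulrC -{1}(gtr0_norm c0) -normrM.
  rewrite -/(z t) -/(z t0).
  have -> : c * (z t - z t0) = (g t - g t0) - (p t - p t0) by rewrite gB; ring.
  rewrite (le_trans (ler_normB _ _))// mulrDl mul1r lerD//.
  by rewrite (le_trans (pL _ _))// ler_wpM2l.
Qed.

Lemma dense_continuous_graph_dim (f : R -> R) (beta e : R) :
  {within `[0, 1], continuous f} -> 1 < beta < 2 -> 0 < e ->
  exists g : R -> R,
  [/\ continuous g, forall t, 0 <= t <= 1 -> `|g t - f t| <= e &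
      hausdorff_dim (@euclidean_dist R) (graph_on `[0, 1] g) = beta%:E].
Proof.
move=> fc /andP[b1 b2] e0; pose H := 2 - beta.
have H01 : 0 < H <= 1 by rewrite /H; lra.
have /andP[H0 H1] := H01.
have [a aH] : exists a, has_rate a H by apply: exists_rate; rewrite ltW.
have e20 : 0 < e / 2 by rewrite divr_gt0.
have [p [L [L0 pL pf]]] := lipschitz_approximation f (e / 2) fc e20.
pose c := e / 4.
have c0 : 0 < c by rewrite divr_gt0.
exists (fun t => p t + c * zigzag a t); split.
- move=> t; apply: cvgD; first exact: lipschitz_continuous L0 pL _.
  by apply: cvgMr; exact: zigzag_continuous H0 aH _.
- move=> t t01; rewrite addrAC (le_trans (ler_normD _ _))//.
  rewrite (_ : e = e / 2 + c * 2); last by rewrite /c; field.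
  rewrite lerD ?pf// normrM gtr0_norm// ler_pM2l//.
  exact: zigzag_le2.
- rewrite (lipschitz_zigzag_dim a p H L c)//.
  by congr (_%:E); rewrite /H; ring.
Qed.

End Density.

Theorem theorem3p19 (R : realType) (f : R -> R) (beta : R)
    (fcont : {within `[0, 1], continuous f}) (hbeta : 1 < beta < 2) :
  exists g : nat -> R -> R,
    [/\ forall n, fractal_function (g n),
        {uniform `[0, 1], g @ \oo --> f} &
        forall n, hausdorff_dim (@euclidean_dist R) (graph_on `[0, 1] (g n))
                  = beta%:E].
Proof.
have /choice[g gP] (n : nat) := dense_continuous_graph_dim f beta n.+1%:R^-1
  fcont hbeta (ltac:(by rewrite invr_gt0) : 0 < n.+1%:R^-1).
exists g; split=> [n||n].
- by apply: continuous_fractal; have [] := gP n.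
- apply: cvg_uniform_le => n t; rewrite /= in_itv/= => t01.
  by have [_ + _] := gP n; apply.
- by have [] := gP n.
Qed.
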